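(* Let $q\in\{1,2\}$, let $\delta(\zeta)=\sum_{i=0}^q\delta_i\zeta^i=\sum_{j=1}^q\frac1j(1-\zeta)^j$ be the generating polynomial of the $q$-step BDF method, and let $\gamma(\zeta)=\sum_{j=0}^{q-1}\gamma_j\zeta^j=\frac{1-(1-\zeta)^q}{\zeta}$ be the generating polynomial of the extrapolation. Then there exist a real (diagonal) matrix $B=(B_{ij})_{i,j=1}^q\in\mathbb{R}^{q\times q}$ and a real vector $a=(a_0,\dots,a_q)\in\mathbb{R}^{q+1}$ such that, for all $w_0,\dots,w_q\in\mathcal{H}$ and for an arbitrary symmetric bilinear form $(\cdot,\cdot)\colon \mathcal{H}\times \mathcal{H}\to\mathbb{R}$, $$\Big(\sum_{i=0}^q\delta_iw_{q-i},\ \sum_{j=0}^{q-1}\gamma_jw_{q-1-j}\Big)=\sum_{i,j=1}^qB_{ij}(w_i,w_j)-\sum_{i,j=1}^qB_{ij}(w_{i-1},w_{j-1})-\Big(\sum_{i=0}^qa_iw_i,\ \sum_{i=0}^qa_iw_i\Big).$$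
   Context: $\mathcal{H}$ is a real Hilbert space. The matrix $B$ and the vector $a$ depend only on $q$, not on $\mathcal{H}$, the bilinear form, or the vectors $w_0,\dots,w_q$. *)

(* Defs.v *)
From HB Require Import structures.
From mathcomp Require Import all_boot all_order all_algebra.
From mathcomp Require Import sesquilinear.
From mathcomp Require Import reals topology normedtype.

Set Implicit Arguments.
Unset Strict Implicit.
Unset Printing Implicit Defensive.

Import Order.TTheory GRing.Theory Num.Theory.
Import numFieldNormedType.Exports.

Local Open Scope ring_scope.

Definition is_hilbert (R : realType) (H : completeNormedModType R) : Prop :=
  exists ip : {dot H for idfun}, forall x : H, `|x| ^+ 2 = ip x x.

Definition bdf_poly (R : realType) (q : nat) : {poly R} :=
  \sum_(1 <= j < q.+1) j%:R^-1 *: (1 - 'X) ^+ j.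

(* The quotient is exact: see [extrap_polyE]. *)
Definition extrap_poly (R : realType) (q : nat) : {poly R} :=
  (1 - (1 - 'X) ^+ q) %/ 'X.

Lemma extrap_polyE (R : realType) (q : nat) :
  extrap_poly R q * 'X = 1 - (1 - 'X) ^+ q.
Proof.
rewrite /extrap_poly divpK // -[X in X %| _]subr0 -polyC0 dvdp_XsubCl.
by rewrite /root !hornerE oppr0 addr0 expr1n subrr.
Qed.

(* Main.v *)
Require Import Defs.
From mathcomp Require Import all_boot all_order all_algebra.
From mathcomp Require Import sesquilinear.
From mathcomp Require Import reals topology normedtype.
From mathcomp Require Import ring.

(** Expanding both sides by bilinearity and comparing the coefficients of the
products of the [w i] gives finitely many equations in [B] and [a], which turn
out to be solvable with [B] diagonal.  The shape of [a] can be foreseen: when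
all the [w i] are equal, the left-hand side vanishes because delta vanishes
at 1, and the two sums in [B] cancel, so the entries of [a] must add up to 0.
Indeed [a] is a multiple [s] of the q-th difference:
- for q = 1, the pair is [(w1 - w0, w0)], with [B = 1/2], [a = s (-1, 1)] and
  [s ^ 2 = 1/2];
- for q = 2, the pair is [(3/2 w2 - 2 w1 + 1/2 w0, 2 w1 - w0)], with
  [B = diag (-1/4, 3/4)], [a = s (1, -2, 1)] and [s ^ 2 = 3/4].
Since both values of [s ^ 2] are positive, a real [s] exists.  The two
quadratic identities are [bdf1_identity] and [bdf2_identity]. *)

Import GRing.Theory Num.Theory.
Local Open Scope ring_scope.

Lemma bdf_poly1 (R : realType) : bdf_poly R 1 = 1 - 'X.
Proof. by rewrite /bdf_poly big_nat1 invr1 scale1r expr1. Qed.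

Lemma bdf_poly2 (R : realType) :
  bdf_poly R 2 = (3 / 2)%:P - 2 *: 'X + 2^-1 *: 'X^2.
Proof.
rewrite /bdf_poly big_nat_recr //= big_nat1 invr1 scale1r expr1.
apply/polyP=> i; rewrite sqrrB expr1n mul1r !coefE.
by case: i => [|[|[|i]]] /=; field.
Qed.

(** The extrapolation polynomial is a Euclidean quotient by ['X], so it is
identified by multiplying back rather than by running the division. *)
Lemma extrap_poly_uniq (R : realType) q (p : {poly R}) :
  p * 'X = 1 - (1 - 'X) ^+ q -> extrap_poly R q = p.
Proof.
by rewrite -extrap_polyE => pX; apply: (mulIf (negbT (polyX_eq0 R))); rewrite pX.
Qed.

Lemma diag_mx_sum (R : realType) q (d : 'rV[R]_q) (F : 'I_q -> 'I_q -> R) :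
  \sum_i \sum_j diag_mx d i j * F i j = \sum_i d 0 i * F i i.
Proof.
apply: eq_bigr => i _; rewrite (bigD1 i) //= mxE eqxx mulr1n big1 ?addr0 // => j.
by rewrite mxE eq_sym => /negPf->; rewrite mul0r.
Qed.

(** Pulling the common factor out of the combination leaves the integer
coefficients of a difference operator; under a quadratic form the irrational
factor then occurs only through its square. *)
Lemma row_scaled_sum (R : realType) (H : lmodType R) n (s : R) (c : seq R)
    (w : 'I_n.+1 -> H) :
  \sum_i (\row_(k < n.+1) (s * c`_k)) 0 i *: w i
  = s *: \sum_(i < n.+1) c`_i *: w (inord i).
Proof.
by rewrite scaler_sumr; apply: eq_bigr => i _; rewrite mxE scalerA inord_val.
Qed.

Section SymmetricForm.
Context (R : realType) (H : lmodType R) (form : {symmetric H}).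

Lemma symmetric_formC (u v : H) : form u v = form v u.
Proof. by rewrite hermC /= expr0 mul1r. Qed.

Lemma symmetric_formDl (u v z : H) : form (u + v) z = form u z + form v z.
Proof. exact: linearDl. Qed.

Lemma symmetric_formDr (u v z : H) : form z (u + v) = form z u + form z v.
Proof. exact: linearDr. Qed.

Lemma symmetric_formNl (u z : H) : form (- u) z = - form u z.
Proof. exact: linearNl. Qed.

Lemma symmetric_formNr (u z : H) : form z (- u) = - form z u.
Proof. exact: linearNr. Qed.

Lemma symmetric_formZl c (u v : H) : form (c *: u) v = c * form u v.
Proof. by rewrite linearZl_LR. Qed.

Lemma symmetric_formZr c (u v : H) : form u (c *: v) = c * form u v.
Proof. by rewrite linearZr_LR. Qed.

Definition symmetric_formE := (symmetric_formDl, symmetric_formDr,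
  symmetric_formNl, symmetric_formNr, symmetric_formZl, symmetric_formZr).

(** The polarization identity [2 (u, v) = (u + v, u + v) - (u, u) - (v, v)], read
for [u = w1 - w0] and [v = w0]. *)
Lemma bdf1_identity (s : R) (w0 w1 : H) : s ^+ 2 = 2^-1 ->
  form (w1 - w0) w0 =
  2^-1 * form w1 w1 - 2^-1 * form w0 w0 - form (s *: (w1 - w0)) (s *: (w1 - w0)).
Proof.
move=> s2.
rewrite [form (s *: _) _]symmetric_formZl [form _ (s *: _)]symmetric_formZr mulrA -expr2 s2.
rewrite !symmetric_formE (symmetric_formC w1 w0) /=.
by field.
Qed.

(** The products [w1 w2], [w0 w1] and [w0 w2] have coefficients [3], [3] and
[-3/2] on the left, that is [-3/4] times those of the squared second
difference.  This gives [s ^ 2 = 3/4]; the squares [w2 w2] and [w0 w0] then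
determine the entries [3/4] and [-1/4], and the coefficient [-4] of [w1 w1] is
consistent with them. *)
Lemma bdf2_identity (s : R) (w0 w1 w2 : H) : s ^+ 2 = 3 / 4 ->
  form ((3 / 2) *: w2 - 2 *: w1 + 2^-1 *: w0) (2 *: w1 - w0) =
  (- 4^-1 * form w1 w1 + 3 / 4 * form w2 w2)
  - (- 4^-1 * form w0 w0 + 3 / 4 * form w1 w1)
  - form (s *: (w2 - 2 *: w1 + w0)) (s *: (w2 - 2 *: w1 + w0)).
Proof.
move=> s2.
rewrite [form (s *: _) _]symmetric_formZl [form _ (s *: _)]symmetric_formZr mulrA -expr2 s2.
rewrite !symmetric_formE.
rewrite (symmetric_formC w1 w0) (symmetric_formC w2 w0) (symmetric_formC w2 w1).
by field.
Qed.

End SymmetricForm.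

Theorem lemma5p3 (R : realType) (q : nat) (hq : q = 1%N \/ q = 2%N) :
  exists (B : 'M[R]_q) (a : 'rV[R]_q.+1),
    is_diag_mx B /\
    forall (H : completeNormedModType R), is_hilbert H ->
    forall (form : {symmetric H}) (w : 'I_q.+1 -> H),
      form (\sum_(i < q.+1) (bdf_poly R q)`_i *: w (inord (q - i)))
           (\sum_(j < q) (extrap_poly R q)`_j *: w (inord (q - 1 - j))) =
      \sum_(i < q) \sum_(j < q) B i j * form (w (inord i.+1)) (w (inord j.+1))
      - \sum_(i < q) \sum_(j < q) B i j * form (w (inord i)) (w (inord j))
      - form (\sum_(i < q.+1) a 0 i *: w i) (\sum_(i < q.+1) a 0 i *: w i).
Proof.
case: hq => ->.
- pose s : R := Num.sqrt 2^-1.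
  have s2 : s ^+ 2 = 2^-1 by rewrite sqr_sqrtr // invr_ge0 ler0n.
  exists (diag_mx (const_mx 2^-1)), (\row_i (s * [:: -1; 1]`_i)).
  split=> [|H _ form w]; first exact: diag_mx_is_diag.
  rewrite row_scaled_sum !diag_mx_sum bdf_poly1 (@extrap_poly_uniq _ 1 1); last first.
    by rewrite mul1r expr1 subKr.
  have -> : \sum_(i < 2) [:: -1; 1]`_i *: w (inord i) = w (inord 1) - w (inord 0).
    by rewrite !big_ord_recl big_ord0 /= scale1r scaleN1r addr0 addrC.
  rewrite !big_ord_recl !big_ord0 !mxE !coefE /=.
  rewrite !(subr0, sub0r, addr0, scale1r, scaleN1r).
  exact: bdf1_identity.
- pose s : R := Num.sqrt (3 / 4).
  have s2 : s ^+ 2 = 3 / 4 by rewrite sqr_sqrtr // divr_ge0 ?ler0n.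
  exists (diag_mx (\row_i [:: - 4^-1; 3 / 4]`_i)), (\row_i (s * [:: 1; -2; 1]`_i)).
  split=> [|H _ form w]; first exact: diag_mx_is_diag.
  rewrite row_scaled_sum !diag_mx_sum bdf_poly2 (@extrap_poly_uniq _ 2 (2%:P - 'X)); last first.
    rewrite sqrrB expr1n polyCMn polyC1; ring.
  have -> : \sum_(i < 3) [:: 1; -2; 1]`_i *: w (inord i)
            = w (inord 2) - 2 *: w (inord 1) + w (inord 0).
    rewrite !big_ord_recl big_ord0 /= !scale1r scaleNr addr0.
    by rewrite addrC [in RHS]addrAC [in RHS]addrC addrA.
  rewrite !big_ord_recl !big_ord0 !mxE !coefE /=.
  rewrite !(mulr0, mulr1, subr0, sub0r, addr0, add0r, scale1r, scaleN1r, scaleNr) addrA.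
  exact: bdf2_identity.
Qed.
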